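(* Let $a,b,c,d,e,f,n$ be (complex) parameters, and for $k\in\mathbb{N}_0$ set $$F(n,k) := \frac{(a)_{k+f}\,(b)_{k+e}}{(n)_{k+d}\,(n)_{k+c}},\qquad G(n,k) := R(n,k)\,F(n,k),\qquad \mathcal{F}(n) := \sum_{k=0}^{\infty}F(n,k),$$ where $R(n,k) = -n^2\big(a b-a c-a d+a e-a k-2 a n+a-b c-b d+b f-b k-2 b n+b+c^2+c d-c e-c f+c k+3 c n-c+d^2-d e-d f+d k+3 d n-d+e f-e k-2 e n+e-f k-2 f n+f+2 k n+3 n^2-2 n\big)$. Assume that all the quantities $F(n,k)$, $F(n+1,k)$ ($k\in\mathbb{N}_0$) are defined, that the series $\mathcal{F}(n)$ and $\mathcal{F}(n+1)$ converge, and that $p_2(n)\neq 0$, where $p_1(n),p_2(n)$ are given below. Then $$\mathcal{F}(n) = g_1(n) + g_2(n)\,\mathcal{F}(n+1),\qquad g_1(n) = \frac{-G(n,0)}{p_2(n)},\quad g_2(n) = -\frac{p_1(n)}{p_2(n)},$$ where $p_1(n)$ and $p_2(n)$ are the following polynomials: $p_{1}(n) = -a^2 b^2 + a^2 b c + a^2 b d - 2 a^2 b e + 2 a^2 b n - a^2 c d + a^2 c e - a^2 c n + a^2 d e - a^2 d n - a^2 e^2 + 2 a^2 e n - a^2 n^2 + a b^2 c + a b^2 d - 2 a b^2 f + 2 a b^2 n - a b c^2 - 2 a b c d + 2 a b c e + 2 a b c f - 4 a b c n - a b d^2 + 2 a b d e + 2 a b d f - 4 a b d n - 4 a b e f + 4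 a b e n + 4 a b f n - 4 a b n^2 + a c^2 d - a c^2 e + a c^2 n + a c d^2 - 2 a c d e - 2 a c d f + 4 a c d n + a c e^2 + 2 a c e f - 4 a c e n - 2 a c f n + 3 a c n^2 - a d^2 e + a d^2 n + a d e^2 + 2 a d e f - 4 a d e n - 2 a d f n + 3 a d n^2 - 2 a e^2 f + 2 a e^2 n + 4 a e f n - 4 a e n^2 - 2 a f n^2 + 2 a n^3 - b^2 c d + b^2 c f - b^2 c n + b^2 d f - b^2 d n - b^2 f^2 + 2 b^2 f n - b^2 n^2 + b c^2 d - b c^2 f + b c^2 n + b c d^2 - 2 b c d e - 2 b c d f + 4 b c d n + 2 b c e f - 2 b c e n + b c f^2 - 4 b c f n + 3 b c n^2 - b d^2 f + b d^2 n + 2 b d e f - 2 b d e n + b d f^2 - 4 b d f n + 3 b d n^2 - 2 b e f^2 + 4 b e f n - 2 b e n^2 + 2 b f^2 n - 4 b f n^2 + 2 b n^3 - c^2 d^2 + c^2 d e + c^2 d f - 2 c^2 d n - c^2 e f + c^2 e n + c^2 f n - c^2 n^2 + c d^2 e + c d^2 f - 2 c d^2 n - c d e^2 - 2 c d e f + 4 c d e n - c d f^2 + 4 c d f n - 4 c d n^2 + c e^2 f - c e^2 n + c e f^2 - 4 c e f n + 3 c e n^2 - c f^2 n + 3 c f n^2 - 2 c n^3 - d^2 e f + d^2 e n + d^2 f n - d^2 n^2 + d e^2 f - d e^2 n + d e f^2 - 4 d e f n + 3 d e n^2 - d f^2 n + 3 d f n^2 - 2 d n^3 - e^2 f^2 +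 2 e^2 f n - e^2 n^2 + 2 e f^2 n - 4 e f n^2 + 2 e n^3 - f^2 n^2 + 2 f n^3 - n^4$, $p_{2}(n) = a^2 n^2 - 4 a n^3 + b^2 n^2 - 4 b n^3 + c^2 n^2 + 4 c n^3 + d^2 n^2 + 4 d n^3 + e^2 n^2 - 4 e n^3 + f^2 n^2 - 4 f n^3 - 2 n^3 + 4 n^4 + 2 a b n^2 - 2 a c n^2 - 2 a d n^2 + 2 a e n^2 + 2 a f n^2 - 2 b c n^2 - 2 b d n^2 + 2 b e n^2 + 2 b f n^2 + 2 c d n^2 - 2 c e n^2 - 2 c f n^2 - 2 d e n^2 - 2 d f n^2 + 2 e f n^2 + a n^2 + b n^2 - c n^2 - d n^2 + e n^2 + f n^2$.
   Context: The Pochhammer symbol is $(\alpha)_x = \Gamma(\alpha+x)/\Gamma(\alpha)$ (the index $x$ need not be an integer); for $x=k\in\mathbb{N}_0$ it is the rising factorial $(\alpha)_k=\alpha(\alpha+1)\cdots(\alpha+k-1)$, with $(\alpha)_0=1$. In $F(n+1,k)$ and $\mathcal{F}(n+1)$ the parameter $n$ is replaced by $n+1$ and $a,b,c,d,e,f$ are kept fixed. *)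

(* Defs.v *)
From Stdlib Require Import Reals ZArith.
From Coquelicot Require Import Coquelicot.

Local Open Scope R_scope.
Local Open Scope C_scope.

Definition Cexp (z : C) : C :=
  RtoC (exp (Re z)) * (cos (Im z), sin (Im z)).

(* Componentwise limit; meaningful only when [u] converges in [C]. *)
Definition CLim_seq (u : nat -> C) : C :=
  (real (Lim_seq (fun m => Re (u m))), real (Lim_seq (fun m => Im (u m)))).

(* Componentwise sum; meaningful only when [ex_series u]. *)
Definition CSeries (u : nat -> C) : C :=
  (Series (fun k => Re (u k)), Series (fun k => Im (u k))).

Fixpoint rising (alpha : C) (k : nat) : C :=
  match k with
  | O => RtoC 1
  | S j => rising alpha j * (alpha + RtoC (INR j))
  end.

(* Euler-Gauss: Gamma(z) = lim_m  m! m^z / (z (z + 1) ... (z + m)), with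
   m^z = exp (z ln m); the limit exists exactly when z is not a
   nonpositive integer.  The value of [CGamma] at a pole is irrelevant. *)
Definition CGamma (z : C) : C :=
  CLim_seq (fun m =>
    RtoC (INR (fact m)) * Cexp (z * RtoC (ln (INR m))) / rising z (S m)).

Definition Gamma_pole (z : C) : Prop := exists m : nat, z = - RtoC (INR m).

(* The only natural number that can be equal to x. *)
Definition nat_cand (x : C) : nat := Z.to_nat (Int_part (Re x)).

(* The index x is an arbitrary complex number; for a natural x the symbol is
   the rising factorial, also when alpha is a pole of Gamma. *)
Definition pochhammer (alpha x : C) : C :=
  if Ceq_dec x (RtoC (INR (nat_cand x)))
  then rising alpha (nat_cand x)
  else CGamma (alpha + x) / CGamma alpha.

Definition pochhammer_defined (alpha x : C) : Prop :=
  (exists k : nat, x = RtoC (INR k)) \/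
  (~ Gamma_pole (alpha + x) /\ ~ Gamma_pole alpha).

Definition F (a b c d e f n : C) (k : nat) : C :=
  (pochhammer a (RtoC (INR k) + f) * pochhammer b (RtoC (INR k) + e)) /
  (pochhammer n (RtoC (INR k) + d) * pochhammer n (RtoC (INR k) + c)).

Definition F_defined (a b c d e f n : C) (k : nat) : Prop :=
  pochhammer_defined a (RtoC (INR k) + f) /\
  pochhammer_defined b (RtoC (INR k) + e) /\
  pochhammer_defined n (RtoC (INR k) + d) /\
  pochhammer_defined n (RtoC (INR k) + c) /\
  pochhammer n (RtoC (INR k) + d) <> 0 /\
  pochhammer n (RtoC (INR k) + c) <> 0.

Definition calF (a b c d e f n : C) : C := CSeries (F a b c d e f n).

Definition Rcert (a b c d e f n k : C) : C :=
  - n^2 *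
  (a * b - a * c - a * d + a * e - a * k - 2 * a * n + a - b * c - b * d
  + b * f - b * k - 2 * b * n + b + c^2 + c * d - c * e - c * f + c * k
  + 3 * c * n - c + d^2 - d * e - d * f + d * k + 3 * d * n - d + e * f
  - e * k - 2 * e * n + e - f * k - 2 * f * n + f + 2 * k * n + 3 * n^2
  - 2 * n).

Definition G (a b c d e f n : C) (k : nat) : C :=
  Rcert a b c d e f n (RtoC (INR k)) * F a b c d e f n k.

Definition p1 (a b c d e f n : C) : C :=
  -a^2 * b^2 + a^2 * b * c + a^2 * b * d - 2 * a^2 * b * e + 2 * a^2 * b * n
  - a^2 * c * d + a^2 * c * e - a^2 * c * n + a^2 * d * e - a^2 * d * n
  - a^2 * e^2 + 2 * a^2 * e * n - a^2 * n^2 + a * b^2 * c + a * b^2 * d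
  - 2 * a * b^2 * f + 2 * a * b^2 * n - a * b * c^2 - 2 * a * b * c * d
  + 2 * a * b * c * e + 2 * a * b * c * f - 4 * a * b * c * n - a * b * d^2
  + 2 * a * b * d * e + 2 * a * b * d * f - 4 * a * b * d * n
  - 4 * a * b * e * f + 4 * a * b * e * n + 4 * a * b * f * n
  - 4 * a * b * n^2 + a * c^2 * d - a * c^2 * e + a * c^2 * n + a * c * d^2
  - 2 * a * c * d * e - 2 * a * c * d * f + 4 * a * c * d * n + a * c * e^2
  + 2 * a * c * e * f - 4 * a * c * e * n - 2 * a * c * f * n
  + 3 * a * c * n^2 - a * d^2 * e + a * d^2 * n + a * d * e^2
  + 2 * a * d * e * f - 4 * a * d * e * n - 2 * a * d * f * n
  + 3 * a * d * n^2 - 2 * a * e^2 * f + 2 * a * e^2 * n + 4 * a * e * f * n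
  - 4 * a * e * n^2 - 2 * a * f * n^2 + 2 * a * n^3 - b^2 * c * d
  + b^2 * c * f - b^2 * c * n + b^2 * d * f - b^2 * d * n - b^2 * f^2
  + 2 * b^2 * f * n - b^2 * n^2 + b * c^2 * d - b * c^2 * f + b * c^2 * n
  + b * c * d^2 - 2 * b * c * d * e - 2 * b * c * d * f + 4 * b * c * d * n
  + 2 * b * c * e * f - 2 * b * c * e * n + b * c * f^2 - 4 * b * c * f * n
  + 3 * b * c * n^2 - b * d^2 * f + b * d^2 * n + 2 * b * d * e * f
  - 2 * b * d * e * n + b * d * f^2 - 4 * b * d * f * n + 3 * b * d * n^2
  - 2 * b * e * f^2 + 4 * b * e * f * n - 2 * b * e * n^2 + 2 * b * f^2 * n
  - 4 * b * f * n^2 + 2 * b * n^3 - c^2 * d^2 + c^2 * d * e + c^2 * d * f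
  - 2 * c^2 * d * n - c^2 * e * f + c^2 * e * n + c^2 * f * n - c^2 * n^2
  + c * d^2 * e + c * d^2 * f - 2 * c * d^2 * n - c * d * e^2
  - 2 * c * d * e * f + 4 * c * d * e * n - c * d * f^2 + 4 * c * d * f * n
  - 4 * c * d * n^2 + c * e^2 * f - c * e^2 * n + c * e * f^2
  - 4 * c * e * f * n + 3 * c * e * n^2 - c * f^2 * n + 3 * c * f * n^2
  - 2 * c * n^3 - d^2 * e * f + d^2 * e * n + d^2 * f * n - d^2 * n^2
  + d * e^2 * f - d * e^2 * n + d * e * f^2 - 4 * d * e * f * n
  + 3 * d * e * n^2 - d * f^2 * n + 3 * d * f * n^2 - 2 * d * n^3 - e^2 * f^2
  + 2 * e^2 * f * n - e^2 * n^2 + 2 * e * f^2 * n - 4 * e * f * n^2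
  + 2 * e * n^3 - f^2 * n^2 + 2 * f * n^3 - n^4.

Definition p2 (a b c d e f n : C) : C :=
  a^2 * n^2 - 4 * a * n^3 + b^2 * n^2 - 4 * b * n^3 + c^2 * n^2 + 4 * c * n^3
  + d^2 * n^2 + 4 * d * n^3 + e^2 * n^2 - 4 * e * n^3 + f^2 * n^2
  - 4 * f * n^3 - 2 * n^3 + 4 * n^4 + 2 * a * b * n^2 - 2 * a * c * n^2
  - 2 * a * d * n^2 + 2 * a * e * n^2 + 2 * a * f * n^2 - 2 * b * c * n^2
  - 2 * b * d * n^2 + 2 * b * e * n^2 + 2 * b * f * n^2 + 2 * c * d * n^2
  - 2 * c * e * n^2 - 2 * c * f * n^2 - 2 * d * e * n^2 - 2 * d * f * n^2
  + 2 * e * f * n^2 + a * n^2 + b * n^2 - c * n^2 - d * n^2 + e * n^2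
  + f * n^2.

Definition g1 (a b c d e f n : C) : C :=
  - G a b c d e f n 0 / p2 a b c d e f n.

Definition g2 (a b c d e f n : C) : C :=
  - (p1 a b c d e f n / p2 a b c d e f n).

(* Main.v *)
(* For fixed n, (F, G) is a WZ-style pair:
     p2(n) F(n,k) + p1(n) F(n+1,k) = G(n,k+1) - G(n,k),
   a rational-function identity once F(n,k+1)/F(n,k) and F(n+1,k)/F(n,k) are
   known.  Summing over k, the theorem reduces to G(n,k) -> 0.  Convergence of
   the two series already forces G(n,k) to have a limit l; as G(n,k) is F(n,k)
   times a polynomial of degree at most 1 in k, l <> 0 would make the series of
   F(n,k) diverge like the harmonic series.

   The term ratios rest on Gamma(z+1) = z Gamma(z) and Gamma(z) <> 0 off the
   poles.  Both follow from convergence of the Euler-Gauss sequence and of its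
   reciprocal, whose successive ratios are 1 + O(1/m^2). *)

Require Import Defs.
From Stdlib Require Import Reals ZArith Factorial Lra Lia Classical.
From Coquelicot Require Import Coquelicot.

Local Open Scope R_scope.
Local Open Scope C_scope.

(** * Limits and series *)

Lemma C_ext (x y : C) : Re x = Re y -> Im x = Im y -> x = y.
Proof. destruct x, y; simpl; intros; subst; reflexivity. Qed.

Lemma Cmod_le_sum (z : C) : (Cmod z <= Rabs (Re z) + Rabs (Im z))%R.
Proof.
  replace z with (RtoC (Re z) + Ci * RtoC (Im z)) at 1
    by (destruct z; apply C_ext; simpl; ring).
  eapply Rle_trans; [apply Cmod_triangle|].
  rewrite Cmod_mult, Cmod_Ci, !Cmod_R; lra.
Qed.

Lemma im_le_Cmod (z : C) : (Rabs (Im z) <= Cmod z)%R.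
Proof.
  eapply Rle_trans; [|apply Rmax_Cmod]; apply Rmax_r.
Qed.

Lemma RtoC_neq0 (x : R) : x <> 0%R -> RtoC x <> 0.
Proof. intros Hx H; now apply RtoC_inj in H. Qed.

Lemma Cinv_neq0 (z : C) : z <> 0 -> / z <> 0.
Proof.
  intros Hz H; apply (RtoC_neq0 1); [lra|].
  rewrite <- (Cinv_r z Hz), H; ring.
Qed.

Lemma INR_S_C (k : nat) : RtoC (INR (S k)) = RtoC (INR k) + 1.
Proof. now rewrite S_INR, RtoC_plus. Qed.

(* Componentwise, to match [CLim_seq] and [CSeries]. *)
Definition Clim (u : nat -> C) (l : C) : Prop :=
  is_lim_seq (fun m => Re (u m)) (Re l) /\
  is_lim_seq (fun m => Im (u m)) (Im l).

Lemma Clim_unique (u : nat -> C) (l1 l2 : C) :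
  Clim u l1 -> Clim u l2 -> l1 = l2.
Proof.
  intros [Hr1 Hi1] [Hr2 Hi2].
  apply is_lim_seq_unique in Hr1, Hi1, Hr2, Hi2.
  apply C_ext; congruence.
Qed.

Lemma Clim_CLim_seq (u : nat -> C) (l : C) : Clim u l -> CLim_seq u = l.
Proof.
  intros [Hr Hi]; apply is_lim_seq_unique in Hr, Hi.
  unfold CLim_seq; rewrite Hr, Hi; now destruct l.
Qed.

Lemma Clim_const (l : C) : Clim (fun _ => l) l.
Proof. split; apply is_lim_seq_const. Qed.

Lemma Clim_ext_loc (u v : nat -> C) (l : C) :
  eventually (fun m => u m = v m) -> Clim u l -> Clim v l.
Proof.
  intros [N HN] [Hr Hi].
  split; [eapply is_lim_seq_ext_loc; [|exact Hr] | eapply is_lim_seq_ext_loc; [|exact Hi]];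
    exists N; intros m Hm; now rewrite (HN m Hm).
Qed.

Lemma Clim_ext (u v : nat -> C) (l : C) :
  (forall m, u m = v m) -> Clim u l -> Clim v l.
Proof. intros H; apply Clim_ext_loc; exists 0%nat; auto. Qed.

Lemma Clim_plus (u v : nat -> C) (l1 l2 : C) :
  Clim u l1 -> Clim v l2 -> Clim (fun m => u m + v m) (l1 + l2).
Proof. intros [Hr1 Hi1] [Hr2 Hi2]; split; now apply is_lim_seq_plus'. Qed.

Lemma Clim_mult (u v : nat -> C) (l1 l2 : C) :
  Clim u l1 -> Clim v l2 -> Clim (fun m => u m * v m) (l1 * l2).
Proof.
  intros [Hr1 Hi1] [Hr2 Hi2]; split; simpl.
  - apply is_lim_seq_minus'; now apply is_lim_seq_mult'.
  - apply is_lim_seq_plus'; now apply is_lim_seq_mult'.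
Qed.

Lemma Clim_incr_n (u : nat -> C) (N : nat) (l : C) :
  Clim (fun m => u (m + N)%nat) l -> Clim u l.
Proof.
  intros [Hr Hi]; split.
  - now apply (is_lim_seq_incr_n (fun m => Re (u m)) N).
  - now apply (is_lim_seq_incr_n (fun m => Im (u m)) N).
Qed.

Lemma Clim_inv_INR : Clim (fun m => RtoC (/ INR m)) 0.
Proof.
  split; simpl; [|apply is_lim_seq_const].
  replace (Finite 0) with (Rbar_inv p_infty) by reflexivity.
  apply is_lim_seq_inv; [apply is_lim_seq_INR | easy].
Qed.

(** A ball in the uniform structure of [C] is a product of balls of the two components. *)
Lemma filterlim_Clim (u : nat -> C) (l : C_UniformSpace) :
  filterlim u eventually (locally l) -> Clim u l.
Proof.
  intros H; rewrite filterlim_locally in H.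
  split; apply is_lim_seq_spec; intros eps;
    (destruct (H eps) as [N HN]; exists N; intros m Hm;
     destruct (HN m Hm) as [H1 H2]; assumption).
Qed.

Lemma Csum_n_parts (u : nat -> C) (m : nat) :
  @sum_n C_AbelianMonoid u m =
  (sum_n (fun k => Re (u k)) m, sum_n (fun k => Im (u k)) m).
Proof.
  induction m as [|m IH].
  - rewrite !sum_O; now destruct (u 0%nat).
  - rewrite !sum_Sn, IH; reflexivity.
Qed.

Lemma sum_n_S (x : nat -> R) (m : nat) :
  sum_n x (S m) = (sum_n x m + x (S m))%R.
Proof. exact (sum_Sn (G := R_AbelianMonoid) x m). Qed.

Lemma ex_series_parts (u : nat -> C) :
  ex_series (K := C_AbsRing) (V := C_NormedModule) u ->
  ex_series (fun k => Re (u k)) /\ ex_series (fun k => Im (u k)).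
Proof.
  intros [l Hl]; destruct (filterlim_Clim _ _ Hl) as [Hr Hi].
  split; [exists (Re l) | exists (Im l)].
  - refine (is_lim_seq_ext _ _ (Finite (Re l)) _ Hr); intros m.
    exact (f_equal Re (Csum_n_parts u m)).
  - refine (is_lim_seq_ext _ _ (Finite (Im l)) _ Hi); intros m.
    exact (f_equal Im (Csum_n_parts u m)).
Qed.

Lemma Clim_CSeries (u : nat -> C) :
  ex_series (K := C_AbsRing) (V := C_NormedModule) u ->
  Clim (@sum_n C_AbelianMonoid u) (CSeries u).
Proof.
  intros Hu; destruct (ex_series_parts u Hu) as [Hr Hi].
  split.
  - eapply is_lim_seq_ext; [|exact (Series_correct _ Hr)]; intros m.
    exact (eq_sym (f_equal Re (Csum_n_parts u m))).
  - eapply is_lim_seq_ext; [|exact (Series_correct _ Hi)]; intros m.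
    exact (eq_sym (f_equal Im (Csum_n_parts u m))).
Qed.

Lemma Clim_series_term (u : nat -> C) :
  ex_series (K := C_AbsRing) (V := C_NormedModule) u -> Clim u 0.
Proof.
  intros Hu; destruct (ex_series_parts u Hu) as [Hr Hi].
  split; now apply ex_series_lim_0.
Qed.

Lemma ex_series_parts_scal (c : C) (u : nat -> C) :
  ex_series (K := C_AbsRing) (V := C_NormedModule) u ->
  ex_series (fun k => Re (c * u k)) /\ ex_series (fun k => Im (c * u k)).
Proof.
  intros Hu; apply (ex_series_parts (fun k => c * u k)).
  exact (@ex_series_scal C_AbsRing C_NormedModule c u Hu).
Qed.

(* The terms would dominate [l / 2 * (ln (m + 2) - ln (m + 1))], whose sum
   diverges. *)
Lemma series_mul_INR_lim_nonpos (x : nat -> R) (l : R) :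
  ex_series x -> is_lim_seq (fun m => INR m * x m)%R l -> (l <= 0)%R.
Proof.
  intros [s Hs] Hl.
  destruct (Rle_lt_dec l 0) as [|Hpos]; [assumption|exfalso].
  (* The tolerance [l / 2] keeps [INR m * x m] above [l / 2] from [N] on. *)
  assert (Hh : (0 < l / 2)%R) by lra.
  pose proof (proj2 (is_lim_seq_spec _ _) Hl (mkposreal _ Hh)) as [N HN];
    simpl in HN.
  assert (Hlow : forall m, (S N <= m)%nat ->
    (l / 2 * ln (INR m + 1) - l / 2 * ln (INR (S N) + 1)
     + sum_n x (S N) <= sum_n x m)%R).
  { intros m Hm; induction Hm as [|m Hm IH]; [lra|].
    rewrite (sum_n_S x m).
    assert (Hm0 : (0 < INR (S m))%R) by (apply lt_0_INR; lia).
    assert (Hx : (l / 2 / INR (S m) <= x (S m))%R).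
    { specialize (HN (S m) ltac:(lia)); apply Rabs_def2 in HN.
      apply Rle_div_l; [assumption|]; rewrite Rmult_comm; lra. }
    (* This is [ln (1 + t) <= t] at [t = 1 / (m + 1)], obtained from [1 + t <= exp t]. *)
    assert (Hln : (ln (INR (S m) + 1) - ln (INR m + 1) <= / INR (S m))%R).
    { rewrite <- (S_INR m), <- ln_div by lra.
      replace ((INR (S m) + 1) / INR (S m))%R with (1 + / INR (S m))%R
        by (field; lra).
      rewrite <- (ln_exp (/ INR (S m))) at 2.
      apply ln_le; [|apply exp_ineq1_le].
      pose proof (Rinv_0_lt_compat _ Hm0); lra. }
    apply (Rmult_le_compat_l (l / 2)) in Hln; [|lra].
    unfold Rdiv in Hx, Hln |- *; lra. }
  assert (Hinf : is_lim_seq (sum_n x) p_infty).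
  { eapply is_lim_seq_le_p_loc; [exists (S N); exact Hlow|].
    eapply is_lim_seq_ext with (u := fun m =>
      ((sum_n x (S N) - l / 2 * ln (INR (S N) + 1))
       + l / 2 * ln (INR m + 1))%R); [intros; simpl; lra|].
    eapply is_lim_seq_plus with (l2 := p_infty);
      [apply is_lim_seq_const| |reflexivity].
    replace p_infty with (Rbar_mult (l / 2)%R p_infty).
    2:{ simpl; destruct (Rle_dec 0 (l / 2)); [|lra].
        destruct (Rle_lt_or_eq_dec _ _ _); [reflexivity|lra]. }
    apply is_lim_seq_scal_l.
    apply is_lim_seq_ext with (u := fun m => ln (INR (S m)));
      [intros; now rewrite S_INR|].
    apply (is_lim_comp_seq ln (fun m => INR (S m)) p_infty p_infty is_lim_ln_p).
    - exists 0%nat; easy.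
    - apply (is_lim_seq_incr_1 INR), is_lim_seq_INR. }
  apply is_lim_seq_unique in Hinf.
  pose proof (is_lim_seq_unique (sum_n x) (Finite s) Hs); congruence.
Qed.

(** The one-sided bound applies to both [x] and [- x]. *)
Lemma series_mul_INR_lim (x : nat -> R) (l : R) :
  ex_series x -> is_lim_seq (fun m => INR m * x m)%R l -> l = 0%R.
Proof.
  intros Hx Hl; apply Rle_antisym.
  - exact (series_mul_INR_lim_nonpos x l Hx Hl).
  - enough (- l <= 0)%R by lra.
    apply (series_mul_INR_lim_nonpos (fun m => - x m)%R).
    + exact (ex_series_opp (V := R_NormedModule) x Hx).
    + eapply is_lim_seq_ext; [|apply is_lim_seq_opp in Hl; exact Hl].
      intros; simpl; ring.
Qed.

(** * Convergence from summable increments and ratios *)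

Lemma ex_lim_summable_diff (x e : nat -> R) :
  (forall m, Rabs (x (S m) - x m) <= e m)%R -> ex_series e ->
  exists l : R, is_lim_seq x l.
Proof.
  intros Hd He.
  destruct (ex_series_le (K := R_AbsRing) (V := R_CompleteNormedModule)
              (fun m => x (S m) - x m)%R e Hd He) as [s Hs].
  change (is_lim_seq (sum_n (fun m => x (S m) - x m)%R) (Finite s)) in Hs.
  (* The increments up to index [m] telescope to [x (S m) - x 0], hence the constant [x 0] and the
     shift by one. *)
  exists (s + x 0%nat)%R; apply is_lim_seq_incr_1.
  eapply is_lim_seq_ext;
    [|apply is_lim_seq_plus'; [exact Hs|apply is_lim_seq_const]].
  intros m; simpl; induction m as [|m IH].
  - rewrite sum_O; ring.
  - rewrite sum_n_S, <- IH; ring.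
Qed.

Lemma sum_n_nonneg_le_Series (e : nat -> R) (m : nat) :
  (forall k, 0 <= e k)%R -> ex_series e -> (sum_n e m <= Series e)%R.
Proof.
  intros H0 He.
  apply (is_lim_seq_incr_compare (sum_n e)).
  - now apply Series_correct.
  - intros k; rewrite sum_n_S.
    specialize (H0 (S k)); lra.
Qed.

(* The ratio condition bounds [u] by [exp (Series e)], which makes the
   increments of [u] summable. *)
Lemma Clim_summable_ratio (u : nat -> C) (e : nat -> R) (N : nat) :
  (forall m, 0 <= e m)%R -> ex_series e ->
  (forall m, (N <= m)%nat -> Cmod (u (S m) - u m) <= e m * Cmod (u m))%R ->
  exists l, Clim u l.
Proof.
  intros H0 He Hu.
  pose (v m := u (m + N)%nat); pose (e' m := e (N + m)%nat).
  assert (He' : ex_series e') by exact (proj1 (ex_series_incr_n e N) He).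
  assert (H0' : forall m, (0 <= e' m)%R) by (intros; apply H0).
  assert (Hv : forall m, (Cmod (v (S m) - v m) <= e' m * Cmod (v m))%R).
  { intros m; unfold v, e'; rewrite (Nat.add_comm N m).
    apply (Hu (m + N)%nat); lia. }
  (* Each step multiplies the modulus by at most [1 + e' m <= exp (e' m)]. Since [sum_n e' m]
     includes index [m], the bound concerns [v (S m)]; [v 0] is treated separately below. *)
  assert (HS : forall m, (Cmod (v (S m)) <= Cmod (v 0%nat) * exp (sum_n e' m))%R).
  { assert (Hstep : forall m, (Cmod (v (S m)) <= Cmod (v m) * exp (e' m))%R).
    { intros m.
      replace (v (S m)) with (v m + (v (S m) - v m)) by ring.
      eapply Rle_trans; [apply Cmod_triangle|].
      pose proof (Hv m); pose proof (exp_ineq1_le (e' m)).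
      pose proof (Cmod_ge_0 (v m)); nra. }
    induction m as [|m IH]; [rewrite sum_O; apply Hstep|].
    rewrite sum_n_S.
    rewrite exp_plus, <- Rmult_assoc.
    eapply Rle_trans; [apply Hstep|].
    apply Rmult_le_compat_r; [left; apply exp_pos|exact IH]. }
  assert (HB : exists B, forall m, (Cmod (v m) <= B)%R).
  { exists (Cmod (v 0%nat) * exp (Series e'))%R; intros [|m].
    - assert (0 <= Series e')%R
        by (eapply Rle_trans; [apply (H0' 0%nat)|];
            rewrite <- (sum_O e'); now apply sum_n_nonneg_le_Series).
      pose proof (exp_ineq1_le (Series e')); pose proof (Cmod_ge_0 (v 0%nat)).
      nra.
    - eapply Rle_trans; [apply HS|].
      apply Rmult_le_compat_l; [apply Cmod_ge_0|].
      pose proof (sum_n_nonneg_le_Series e' m H0' He') as [H|H];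
        [left; now apply exp_increasing|rewrite H; right; reflexivity]. }
  destruct HB as [B HB].
  assert (Hd : forall m, (Cmod (v (S m) - v m) <= B * e' m)%R).
  { intros m; eapply Rle_trans; [apply Hv|].
    rewrite Rmult_comm; apply Rmult_le_compat_r; auto. }
  assert (HBe : ex_series (fun m => B * e' m)%R)
    by exact (ex_series_scal_l (K := R_AbsRing) (V := R_NormedModule) B e' He').
  destruct (ex_lim_summable_diff (fun m => Re (v m)) (fun m => B * e' m)%R)
    as [lr Hr]; [|assumption|].
  { intros m; eapply Rle_trans; [|apply Hd].
    eapply Rle_trans; [|apply re_le_Cmod]; right; reflexivity. }
  destruct (ex_lim_summable_diff (fun m => Im (v m)) (fun m => B * e' m)%R)
    as [li Hi]; [|assumption|].
  { intros m; eapply Rle_trans; [|apply Hd].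
    eapply Rle_trans; [|apply im_le_Cmod]; right; reflexivity. }
  exists (lr, li); apply (Clim_incr_n u N); now split.
Qed.

(** A telescoping substitute for the series of [1 / m ^ 2]: the partial sums are
    [1 - 1 / (m + 2)]. *)
Lemma ex_series_inv_consecutive :
  ex_series (fun m => / ((INR m + 1) * (INR m + 2)))%R.
Proof.
  exists 1%R.
  change (is_lim_seq (sum_n (fun m => / ((INR m + 1) * (INR m + 2)))%R) 1).
  apply (is_lim_seq_ext (fun m => 1 + - / (INR (S (S m))))%R).
  - intros m; induction m as [|m IH].
    + rewrite sum_O; simpl; lra.
    + rewrite sum_n_S, <- IH.
      pose proof (pos_INR m); rewrite !S_INR; field; lra.
  - replace (Finite 1) with (Finite (1 + - 0)) by (f_equal; ring).
    apply is_lim_seq_plus'; [apply is_lim_seq_const|].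
    apply (is_lim_seq_opp _ (Finite 0)).
    apply (is_lim_seq_incr_1 (fun m => / INR (S m))%R).
    apply (is_lim_seq_incr_1 (fun m => / INR m)%R).
    apply Clim_inv_INR.
Qed.

(** * The Gamma function *)

(** The lower bound is [1 + x <= exp x]. The same inequality at [- x] gives [exp x <= 1 / (1 - x)],
    so the remainder is at most [x ^ 2 / (1 - x)], and [1 - x >= 1 / 2]. *)
Lemma exp_taylor1 (x : R) :
  (Rabs x <= 1 / 2)%R -> (0 <= exp x - 1 - x <= 2 * x ^ 2)%R.
Proof.
  intros Hx; apply Rabs_le_between in Hx.
  split; [pose proof (exp_ineq1_le x); lra|].
  assert (H : (exp x * (1 - x) <= 1)%R).
  { replace 1%R with (exp x * exp (- x))%R at 2
      by (rewrite <- exp_plus, Rplus_opp_r; apply exp_0).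
    apply Rmult_le_compat_l; [left; apply exp_pos|].
    pose proof (exp_ineq1_le (- x)); lra. }
  nra.
Qed.

Lemma Rabs_sin_le (y : R) : (Rabs (sin y) <= Rabs y)%R.
Proof.
  destruct (MVT_gen sin 0 y cos) as [c [_ Hc]].
  - intros; apply is_derive_sin.
  - intros; apply continuity_sin.
  - rewrite sin_0, !Rminus_0_r in Hc; rewrite Hc, Rabs_mult.
    pose proof (COS_bound c); pose proof (Rabs_pos y).
    assert (Rabs (cos c) <= 1)%R by (apply Rabs_le; lra); nra.
Qed.

(** By the half-angle formula the middle term is [2 sin (y / 2) ^ 2]. *)
Lemma one_minus_cos_bound (y : R) : (0 <= 1 - cos y <= y ^ 2 / 2)%R.
Proof.
  split; [pose proof (COS_bound y); lra|].
  replace y with (2 * (y / 2))%R at 1 by field.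
  rewrite cos_2a_sin.
  pose proof (Rsqr_le_abs_1 _ _ (Rabs_sin_le (y / 2))) as H.
  unfold Rsqr in H; nra.
Qed.

(** Mean value theorem for [sin t - t]: the derivative [cos c - 1] is at most [c ^ 2 / 2] in
    modulus, with [c] between 0 and [y]. *)
Lemma sin_taylor1 (y : R) : (Rabs y <= 1)%R -> (Rabs (sin y - y) <= y ^ 2)%R.
Proof.
  intros Hy.
  destruct (MVT_gen (fun t => sin t - t)%R 0 y (fun t => cos t - 1)%R)
    as [c [Hc Heq]].
  - intros; auto_derive; [trivial|ring].
  - intros; apply continuity_pt_minus;
      [apply continuity_sin|apply continuity_pt_id].
  - rewrite sin_0, !Rminus_0_r in Heq; rewrite Heq, Rabs_mult.
    assert (Hca : (Rabs c <= Rabs y)%R).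
    { unfold Rmin, Rmax in Hc; destruct (Rle_dec 0 y);
        unfold Rabs; destruct (Rcase_abs c), (Rcase_abs y); lra. }
    pose proof (one_minus_cos_bound c) as Hb.
    replace (Rabs (cos c - 1)) with (1 - cos c)%R
      by (rewrite Rabs_minus_sym, Rabs_pos_eq; lra).
    rewrite <- (pow2_abs y); rewrite <- (pow2_abs c) in Hb.
    pose proof (Rabs_pos c); pose proof (Rabs_pos y); nra.
Qed.

(** Each component is regrouped into terms of second order by the real estimates; the constant is 4
    for the real part plus 6 for the imaginary part. *)
Lemma Cexp_taylor1 (w : C) :
  (Cmod w <= 1 / 2)%R -> (Cmod (Cexp w - 1 - w) <= 10 * Cmod w ^ 2)%R.
Proof.
  intros Hw.
  pose proof (re_le_Cmod w) as Hx; pose proof (im_le_Cmod w) as Hy.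
  destruct w as [x y]; unfold Re, Im in Hx, Hy; simpl in Hx, Hy.
  set (r := Cmod (x, y)) in *.
  pose proof (exp_taylor1 x ltac:(lra)) as He.
  pose proof (one_minus_cos_bound y) as Hc.
  pose proof (sin_taylor1 y ltac:(lra)) as Hs.
  pose proof (Rabs_sin_le y) as Hs'.
  pose proof (Rabs_pos x) as Hx0; pose proof (Rabs_pos y) as Hy0.
  pose proof (pow2_abs x) as Hx2; pose proof (pow2_abs y) as Hy2.
  eapply Rle_trans; [apply Cmod_le_sum|].
  assert (Hre : (Rabs (Re (Cexp (x, y) - 1 - (x, y))) <= 4 * r ^ 2)%R).
  { replace (Re (Cexp (x, y) - 1 - (x, y)))
      with ((exp x - 1 - x) * cos y + (1 + x) * (cos y - 1))%R
      by (simpl; ring).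
    eapply Rle_trans; [apply Rabs_triang|]; rewrite !Rabs_mult.
    rewrite (Rabs_pos_eq (exp x - 1 - x)) by lra.
    replace (Rabs (cos y - 1)) with (1 - cos y)%R
      by (rewrite Rabs_minus_sym, Rabs_pos_eq; lra).
    assert (Rabs (cos y) <= 1)%R
      by (pose proof (COS_bound y); apply Rabs_le; lra).
    assert (Rabs (1 + x) <= 2)%R
      by (eapply Rle_trans; [apply Rabs_triang|]; rewrite Rabs_R1; lra).
    pose proof (Rabs_pos (cos y)); pose proof (Rabs_pos (1 + x)).
    assert ((exp x - 1 - x) * Rabs (cos y) <= 2 * x ^ 2)%R by nra.
    assert (Rabs (1 + x) * (1 - cos y) <= y ^ 2)%R by nra.
    assert (x ^ 2 <= r ^ 2)%R by nra.
    assert (y ^ 2 <= r ^ 2)%R by nra.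
    pose proof (pow2_ge_0 r); lra. }
  assert (Him : (Rabs (Im (Cexp (x, y) - 1 - (x, y))) <= 6 * r ^ 2)%R).
  { replace (Im (Cexp (x, y) - 1 - (x, y)))
      with ((exp x - 1) * sin y + (sin y - y))%R by (simpl; ring).
    eapply Rle_trans; [apply Rabs_triang|]; rewrite Rabs_mult.
    assert (He1 : (Rabs (exp x - 1) <= 3 * Rabs x)%R).
    { replace (exp x - 1)%R with ((exp x - 1 - x) + x)%R by ring.
      eapply Rle_trans; [apply Rabs_triang|].
      rewrite (Rabs_pos_eq (exp x - 1 - x)) by lra; nra. }
    pose proof (Rabs_pos (sin y)); pose proof (Rabs_pos (exp x - 1)).
    assert (Rabs (exp x - 1) * Rabs (sin y) <= 3 * Rabs x * Rabs y)%R by nra.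
    assert (Rabs x * Rabs y <= r ^ 2)%R by nra.
    assert (y ^ 2 <= r ^ 2)%R by nra.
    pose proof (pow2_ge_0 r); lra. }
  lra.
Qed.

Lemma Cexp_plus (w z : C) : Cexp (w + z) = Cexp w * Cexp z.
Proof.
  destruct w as [a b], z as [c d]; unfold Cexp; simpl.
  rewrite exp_plus, cos_plus, sin_plus; apply C_ext; simpl; ring.
Qed.

Lemma Cexp_RtoC (x : R) : Cexp (RtoC x) = RtoC (exp x).
Proof.
  unfold Cexp; simpl; rewrite cos_0, sin_0; apply C_ext; simpl; ring.
Qed.

Lemma Cmod_Cexp (w : C) : Cmod (Cexp w) = exp (Re w).
Proof.
  unfold Cexp; rewrite Cmod_mult, Cmod_R, Rabs_pos_eq by (left; apply exp_pos).
  unfold Cmod; cbn [fst snd].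
  replace (cos (Im w) ^ 2 + sin (Im w) ^ 2)%R with 1%R
    by (pose proof (sin2_cos2 (Im w)) as H; unfold Rsqr in H; lra).
  rewrite sqrt_1; ring.
Qed.

Lemma Cexp_neq0 (w : C) : Cexp w <> 0.
Proof.
  apply Cmod_gt_0; rewrite Cmod_Cexp; apply exp_pos.
Qed.

(** Both bounds come from [1 + t <= exp t], at [t = - 1 / (m + 1)] and at [t = 1 / m]. *)
Lemma ln_succ_ratio_bounds (m : nat) :
  (1 <= m)%nat ->
  (/ (INR m + 1) <= ln (INR (S m)) - ln (INR m) <= / INR m)%R.
Proof.
  intros Hm; assert (Hm0 : (1 <= INR m)%R) by (apply (le_INR 1); lia).
  rewrite S_INR, <- ln_div by lra; split.
  - apply Ropp_le_cancel; rewrite <- ln_Rinv by (apply Rdiv_lt_0_compat; lra).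
    replace (/ ((INR m + 1) / INR m))%R with (1 + - / (INR m + 1))%R
      by (field; lra).
    rewrite <- (ln_exp (- / (INR m + 1))) at 2.
    apply ln_le; [|apply exp_ineq1_le].
    replace (1 + - / (INR m + 1))%R with (INR m / (INR m + 1))%R by (field; lra).
    apply Rdiv_lt_0_compat; lra.
  - replace ((INR m + 1) / INR m)%R with (1 + / INR m)%R by (field; lra).
    rewrite <- (ln_exp (/ INR m)) at 2.
    apply ln_le; [|apply exp_ineq1_le].
    pose proof (Rinv_0_lt_compat (INR m)); lra.
Qed.

(** * The Euler-Gauss sequence and the recurrence of Gamma *)

Definition gauss_seq (z : C) (m : nat) : C :=
  RtoC (INR (fact m)) * Cexp (z * RtoC (ln (INR m))) / rising z (S m).

(* With [s = 1 / (m + 1)] and [L = ln ((m + 1) / m)] this is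
   [exp (z L) / (1 + z s) = 1 + O (1 / m ^ 2)], since [L - s = O (1 / m ^ 2)]. *)
Definition gauss_ratio (z : C) (m : nat) : C :=
  Cexp (z * RtoC (ln (INR (S m)) - ln (INR m))) / (1 + z * RtoC (/ (INR m + 1))).

Lemma not_pole_neq0 (z : C) (k : nat) : ~ Gamma_pole z -> z + RtoC (INR k) <> 0.
Proof.
  intros Hz H; apply Hz; exists k.
  replace z with (z + RtoC (INR k) - RtoC (INR k)) by ring; rewrite H; ring.
Qed.

Lemma not_pole_S (z : C) : ~ Gamma_pole z -> ~ Gamma_pole (z + 1).
Proof.
  intros Hz [m Hm]; apply Hz; exists (S m); rewrite INR_S_C.
  replace z with (z + 1 - 1) by ring; rewrite Hm; ring.
Qed.

Lemma rising_neq0 (z : C) (k : nat) : ~ Gamma_pole z -> rising z k <> 0.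
Proof.
  intros Hz; induction k as [|k IH]; simpl.
  - apply RtoC_neq0; lra.
  - apply Cmult_neq_0; [assumption|now apply not_pole_neq0].
Qed.

(** Both sides are the product [z (z + 1) ... (z + k)]. *)
Lemma rising_shift (z : C) (k : nat) :
  rising (z + 1) k * z = rising z k * (z + RtoC (INR k)).
Proof.
  induction k as [|k IH]; [simpl; ring|].
  rewrite INR_S_C; simpl rising.
  transitivity (rising (z + 1) k * z * (z + 1 + RtoC (INR k))); [ring|].
  rewrite IH; ring.
Qed.

Lemma gauss_seq_neq0 (z : C) (m : nat) : ~ Gamma_pole z -> gauss_seq z m <> 0.
Proof.
  intros Hz; unfold gauss_seq, Cdiv.
  apply Cmult_neq_0; [apply Cmult_neq_0|].
  - apply RtoC_neq0, INR_fact_neq_0.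
  - apply Cexp_neq0.
  - now apply Cinv_neq0, rising_neq0.
Qed.

Lemma gauss_seq_S (z : C) (m : nat) :
  ~ Gamma_pole z -> gauss_seq z (S m) = gauss_seq z m * gauss_ratio z m.
Proof.
  intros Hz; unfold gauss_seq, gauss_ratio.
  replace (z * RtoC (ln (INR (S m)))) with
    (z * RtoC (ln (INR m)) + z * RtoC (ln (INR (S m)) - ln (INR m)))
    by (rewrite RtoC_minus; ring).
  rewrite Cexp_plus, fact_simpl, mult_INR, RtoC_mult.
  change (rising z (S (S m))) with (rising z (S m) * (z + RtoC (INR (S m)))).
  assert (Hm : (INR m + 1 <> 0)%R) by (pose proof (pos_INR m); lra).
  rewrite RtoC_inv, RtoC_plus, INR_S_C by assumption.
  pose proof (rising_neq0 z (S m) Hz).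
  pose proof (not_pole_neq0 z (S m) Hz) as H1; rewrite INR_S_C in H1.
  assert (RtoC (INR m) + 1 <> 0)
    by (rewrite <- RtoC_plus; now apply RtoC_neq0).
  field; repeat split; auto.
  intros Hz0; apply H1; rewrite <- Hz0; ring.
Qed.

(** Write the ratio as [E / Q]. Then [E / Q - 1 = (E - Q) / Q] and [Q / E - 1 = - (E - Q) / E], so
    one bound on [E - Q], with [E] and [Q] at least 1/2 in modulus, settles both estimates. *)
Lemma gauss_ratio_bound (z : C) :
  exists K : R, exists N : nat, (0 <= K)%R /\ forall m : nat, (N <= m)%nat ->
    gauss_ratio z m <> 0 /\
    (Cmod (gauss_ratio z m - 1) <= K * / ((INR m + 1) * (INR m + 2)))%R /\
    (Cmod (/ gauss_ratio z m - 1) <= K * / ((INR m + 1) * (INR m + 2)))%R.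
Proof.
  set (r := Cmod z); assert (Hr : (0 <= r)%R) by apply Cmod_ge_0.
  (* In [M], [10 * r ^ 2] is the Taylor remainder of [Cexp] and [r] accounts for replacing [L] by
     [s]. The factor 12 is 2, from dividing by a modulus at least 1/2, times 6, from
     [(x + 1) * (x + 2) <= 6 * x ^ 2] for [x >= 1]. *)
  set (M := (10 * r ^ 2 + r)%R); assert (HM : (0 <= M)%R) by (unfold M; nra).
  exists (12 * M)%R.
  (* Beyond this [N], [r / x <= 1 / 2], so both [z L] and [z s] have modulus at most 1/2. *)
  destruct (nfloor_ex (2 * r + 1)) as [N HN]; [lra|].
  exists (S N); split; [lra|].
  intros m Hm; unfold gauss_ratio.
  assert (HmR : (2 * r + 1 <= INR m)%R)
    by (apply le_INR in Hm; rewrite S_INR in Hm; lra).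
  set (x := INR m) in *.
  pose proof (ln_succ_ratio_bounds m ltac:(lia)) as HL; fold x in HL.
  set (L := (ln (INR (S m)) - ln x)%R) in *.
  set (s := (/ (x + 1))%R) in *.
  assert (Hs : (0 < s)%R) by (apply Rinv_0_lt_compat; lra).
  assert (Hrx : (r * / x <= 1 / 2)%R).
  { apply (Rmult_le_reg_r x); [lra|].
    rewrite Rmult_assoc, Rinv_l; lra. }
  assert (HzL : (Cmod (z * RtoC L) = r * L)%R)
    by (rewrite Cmod_mult, Cmod_R, Rabs_pos_eq; [reflexivity|lra]).
  assert (HrL : (r * L <= 1 / 2)%R) by nra.
  assert (Hx2 : (/ x - s <= / x ^ 2)%R).
  { replace (/ x - s)%R with (/ (x * (x + 1)))%R by (unfold s; field; lra).
    apply Rinv_le_contravar; nra. }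
  assert (HD : (Cmod (Cexp (z * RtoC L) - (1 + z * RtoC s)) <= M * / x ^ 2)%R).
  { replace (Cexp (z * RtoC L) - (1 + z * RtoC s)) with
      ((Cexp (z * RtoC L) - 1 - z * RtoC L) + z * RtoC (L - s))
      by (rewrite RtoC_minus; ring).
    eapply Rle_trans; [apply Cmod_triangle|].
    pose proof (Cexp_taylor1 (z * RtoC L) ltac:(lra)) as Ht.
    rewrite HzL in Ht; rewrite Cmod_mult, Cmod_R, Rabs_pos_eq by lra.
    fold r.
    assert (L ^ 2 <= / x ^ 2)%R
      by (rewrite <- pow_inv; apply pow_incr; lra).
    assert (r * (L - s) <= r * / x ^ 2)%R by (apply Rmult_le_compat_l; lra).
    assert (r ^ 2 * L ^ 2 <= r ^ 2 * / x ^ 2)%R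
      by (apply Rmult_le_compat_l; [apply pow2_ge_0|lra]).
    rewrite Rpow_mult_distr in Ht; unfold M; lra. }
  assert (Hden : (/ 2 <= Cmod (1 + z * RtoC s))%R).
  { assert (Hzs : (Cmod (z * RtoC s) <= 1 / 2)%R).
    { rewrite Cmod_mult, Cmod_R, Rabs_pos_eq by lra; fold r; nra. }
    assert (H1 : (Cmod (RtoC 1) <= Cmod (1 + z * RtoC s) + Cmod (- (z * RtoC s)))%R).
    { eapply Rle_trans; [|apply Cmod_triangle]; right; f_equal; ring. }
    rewrite Cmod_1, Cmod_opp in H1; lra. }
  assert (Hexp : (/ 2 <= Cmod (Cexp (z * RtoC L)))%R).
  { rewrite Cmod_Cexp.
    pose proof (re_le_Cmod (z * RtoC L)) as H1; apply Rabs_le_between in H1.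
    pose proof (exp_ineq1_le (Re (z * RtoC L))); lra. }
  assert (Hxx : (/ x ^ 2 <= 6 * / ((x + 1) * (x + 2)))%R).
  { apply (Rmult_le_reg_r (x ^ 2 * ((x + 1) * (x + 2)))); [nra|].
    field_simplify; [nra|nra|lra]. }
  assert (Hquot : forall p q : C, (/ 2 <= Cmod q)%R ->
    (Cmod p <= M * / x ^ 2)%R ->
    (Cmod (p / q) <= 12 * M * / ((x + 1) * (x + 2)))%R).
  { intros p q Hq Hp.
    assert (Hq0 : q <> 0) by (apply Cmod_gt_0; lra).
    rewrite Cmod_div by assumption.
    apply Rle_div_l; [lra|].
    assert (M * / x ^ 2 <= M * (6 * / ((x + 1) * (x + 2))))%R
      by (apply Rmult_le_compat_l; lra).
    assert (0 < / ((x + 1) * (x + 2)))%R by (apply Rinv_0_lt_compat; nra).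
    assert (0 <= 12 * M * / ((x + 1) * (x + 2)))%R by nra.
    nra. }
  set (E := Cexp (z * RtoC L)) in *.
  set (Q := 1 + z * RtoC s) in *.
  assert (HE : E <> 0) by (apply Cmod_gt_0; lra).
  assert (HQ : Q <> 0) by (apply Cmod_gt_0; lra).
  repeat split.
  - unfold Cdiv; apply Cmult_neq_0; [assumption|now apply Cinv_neq0].
  - replace (E / Q - 1) with ((E - Q) / Q) by (field; assumption).
    now apply Hquot.
  - replace (/ (E / Q) - 1) with (- (E - Q) / E) by (field; split; assumption).
    apply Hquot; [assumption|now rewrite Cmod_opp].
Qed.

(* The reciprocal sequence also converges, by the same ratio estimate, so the
   limit cannot vanish. *)
Lemma Clim_gauss_seq (z : C) :
  ~ Gamma_pole z -> Clim (gauss_seq z) (CGamma z) /\ CGamma z <> 0.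
Proof.
  intros Hz.
  destruct (gauss_ratio_bound z) as [K [N [HK Hb]]].
  pose (e m := (K * / ((INR m + 1) * (INR m + 2)))%R).
  assert (He : ex_series e)
    by exact (ex_series_scal_l (K := R_AbsRing) (V := R_NormedModule) K _
                ex_series_inv_consecutive).
  assert (He0 : forall m, (0 <= e m)%R).
  { intros m; apply Rmult_le_pos; [assumption|].
    pose proof (pos_INR m); left; apply Rinv_0_lt_compat; nra. }
  destruct (Clim_summable_ratio (gauss_seq z) e N He0 He) as [l Hl].
  { intros m Hm; destruct (Hb m Hm) as [_ [H1 _]].
    rewrite gauss_seq_S by assumption.
    replace (gauss_seq z m * gauss_ratio z m - gauss_seq z m)
      with ((gauss_ratio z m - 1) * gauss_seq z m) by ring.
    rewrite Cmod_mult; apply Rmult_le_compat_r; [apply Cmod_ge_0|exact H1]. }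
  destruct (Clim_summable_ratio (fun m => / gauss_seq z m) e N He0 He)
    as [l' Hl'].
  { intros m Hm; destruct (Hb m Hm) as [H0 [_ H1]].
    rewrite gauss_seq_S by assumption.
    pose proof (gauss_seq_neq0 z m Hz).
    replace (/ (gauss_seq z m * gauss_ratio z m) - / gauss_seq z m)
      with ((/ gauss_ratio z m - 1) * / gauss_seq z m) by (field; auto).
    rewrite Cmod_mult; apply Rmult_le_compat_r; [apply Cmod_ge_0|exact H1]. }
  (* [gauss_seq z] is the sequence under the limit in [CGamma z], so the two agree by conversion. *)
  assert (Hg : CGamma z = l) by exact (Clim_CLim_seq _ _ Hl).
  rewrite Hg; split; [assumption|].
  intros Hl0.
  assert (H1 : RtoC 1 = l * l').
  { apply (Clim_unique (fun m => gauss_seq z m * / gauss_seq z m));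
      [|now apply Clim_mult].
    apply Clim_ext with (2 := Clim_const 1).
    intros m; rewrite Cinv_r; [reflexivity|now apply gauss_seq_neq0]. }
  rewrite Hl0, Cmult_0_l in H1; apply RtoC_inj in H1; lra.
Qed.

Lemma CGamma_neq0 (z : C) : ~ Gamma_pole z -> CGamma z <> 0.
Proof. intros Hz; now apply Clim_gauss_seq. Qed.

(** For [m >= 1] the sequences satisfy [gauss_seq (z + 1) m * (1 + (z + 1) / m) = gauss_seq z m *
    z]. The correcting factor tends to 1, and limits are unique. *)
Lemma CGamma_S (z : C) : ~ Gamma_pole z -> CGamma (z + 1) = CGamma z * z.
Proof.
  intros Hz.
  pose proof (not_pole_S z Hz) as Hz1.
  destruct (Clim_gauss_seq z Hz) as [Hl _].
  destruct (Clim_gauss_seq (z + 1) Hz1) as [Hl1 _].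
  apply (Clim_unique (fun m => gauss_seq z m * z));
    [|now apply Clim_mult; [|apply Clim_const]].
  replace (CGamma (z + 1)) with (CGamma (z + 1) * (1 + (z + 1) * 0)) by ring.
  apply Clim_ext_loc with
    (u := fun m => gauss_seq (z + 1) m * (1 + (z + 1) * RtoC (/ INR m))).
  2:{ apply Clim_mult; [assumption|].
      apply Clim_plus; [apply Clim_const|].
      apply Clim_mult; [apply Clim_const|apply Clim_inv_INR]. }
  (* Index 0 is excluded: [exp (ln m) = m] and the division by [m] require [m > 0]. *)
  exists 1%nat; intros m Hm.
  assert (Hm0 : (1 <= INR m)%R) by (apply (le_INR 1); lia).
  unfold gauss_seq.
  replace ((z + 1) * RtoC (ln (INR m)))
    with (z * RtoC (ln (INR m)) + RtoC (ln (INR m))) by ring.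
  rewrite Cexp_plus, Cexp_RtoC, exp_ln by lra.
  pose proof (rising_shift z (S m)) as Hs; rewrite INR_S_C in Hs.
  pose proof (rising_neq0 z (S m) Hz).
  pose proof (rising_neq0 (z + 1) (S m) Hz1).
  assert (RtoC (INR m) <> 0) by (intros H2; apply RtoC_inj in H2; lra).
  rewrite RtoC_inv by lra.
  transitivity (RtoC (INR (fact m)) * Cexp (z * RtoC (ln (INR m)))
    * (rising z (S m) * (z + (RtoC (INR m) + 1)))
    / (rising z (S m) * rising (z + 1) (S m))).
  - field; auto.
  - rewrite <- Hs; field; auto.
Qed.

(** * Pochhammer symbols and the telescoping identity *)

Lemma pochhammer_nat (alpha : C) (k : nat) :
  pochhammer alpha (RtoC (INR k)) = rising alpha k.
Proof.
  unfold pochhammer, nat_cand; rewrite re_RtoC, Int_part_INR, Nat2Z.id.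
  destruct (Ceq_dec _ _); [reflexivity|congruence].
Qed.

Lemma pochhammer_not_nat (alpha x : C) :
  ~ (exists k : nat, x = RtoC (INR k)) ->
  pochhammer alpha x = CGamma (alpha + x) / CGamma alpha.
Proof.
  intros Hx; unfold pochhammer.
  destruct (Ceq_dec _ _); [exfalso; eauto|reflexivity].
Qed.

(** For natural [x] this is the recursion of [rising]; otherwise it is the recurrence of Gamma at
    [alpha + x], which is not a pole. *)
Lemma pochhammer_S (alpha x : C) :
  pochhammer_defined alpha x ->
  pochhammer alpha (x + 1) = pochhammer alpha x * (alpha + x).
Proof.
  intros Hdef.
  destruct (classic (exists k : nat, x = RtoC (INR k))) as [[k ->]|Hx].
  - now rewrite <- INR_S_C, !pochhammer_nat.
  - destruct Hdef as [Hd|[Hax Ha]]; [contradiction|].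
    pose proof (CGamma_neq0 alpha Ha) as HG.
    rewrite (pochhammer_not_nat alpha x Hx).
    transitivity (CGamma (alpha + (x + 1)) / CGamma alpha).
    + (* If [x + 1] is natural and [x] is not, then [x = -1]. *)
      destruct (classic (exists k : nat, x + 1 = RtoC (INR k))) as [[k Hk]|Hx1].
      * destruct k as [|k].
        (* At index 0 the symbol takes the [rising] branch with value 1, which agrees with
           [CGamma alpha / CGamma alpha]. *)
        -- simpl INR in Hk; rewrite Hk, Cplus_0_r.
           change (RtoC 0) with (RtoC (INR 0)); rewrite pochhammer_nat; simpl.
           field; assumption.
        -- exfalso; apply Hx; exists k; rewrite INR_S_C in Hk.
           replace x with (x + 1 - 1) by ring; rewrite Hk; ring.
      * now apply pochhammer_not_nat.
    + rewrite Cplus_assoc, CGamma_S by assumption; field; assumption.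
Qed.

(** Off the naturals, the numerator and the denominator of the Gamma quotient each shift by one,
    gaining [alpha + x] and [alpha]. *)
Lemma pochhammer_shift (alpha x : C) :
  alpha <> 0 -> pochhammer_defined alpha x ->
  pochhammer (alpha + 1) x * alpha = pochhammer alpha x * (alpha + x).
Proof.
  intros Ha0 Hdef.
  destruct (classic (exists k : nat, x = RtoC (INR k))) as [[k ->]|Hx].
  - rewrite !pochhammer_nat; apply rising_shift.
  - destruct Hdef as [Hd|[Hax Ha]]; [contradiction|].
    rewrite !pochhammer_not_nat by assumption.
    replace (alpha + 1 + x) with (alpha + x + 1) by ring.
    pose proof (CGamma_neq0 alpha Ha).
    rewrite !CGamma_S by assumption; field; split; assumption.
Qed.

(** * Term ratios, the telescoping identity and its summation *)

Lemma p2_n0 (a b c d e f : C) : p2 a b c d e f 0 = 0.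
Proof. unfold p2; ring. Qed.

(** The denominator symbols at [S k] are those at [k] times [n + k + d] and [n + k + c], so their
    not vanishing at [S k] makes these linear factors nonzero. *)
Lemma F_S (a b c d e f n : C) (k : nat) :
  F_defined a b c d e f n k -> F_defined a b c d e f n (S k) ->
  n + RtoC (INR k) + d <> 0 /\ n + RtoC (INR k) + c <> 0 /\
  F a b c d e f n (S k) = F a b c d e f n k *
    ((a + RtoC (INR k) + f) * (b + RtoC (INR k) + e)
     / ((n + RtoC (INR k) + d) * (n + RtoC (INR k) + c))).
Proof.
  unfold F_defined, F; intros [Ha [Hb [Hd [Hc [Hd0 Hc0]]]]] [_ [_ [_ [_ [HSd HSc]]]]].
  assert (Hsh : forall y, RtoC (INR (S k)) + y = RtoC (INR k) + y + 1)
    by (intros; rewrite INR_S_C; ring).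
  rewrite Hsh in HSd, HSc; rewrite !Hsh.
  rewrite pochhammer_S in HSd, HSc by assumption.
  rewrite !pochhammer_S by assumption.
  assert (Hd1 : n + RtoC (INR k) + d <> 0).
  { intros H; apply HSd; rewrite Cplus_assoc, H; ring. }
  assert (Hc1 : n + RtoC (INR k) + c <> 0).
  { intros H; apply HSc; rewrite Cplus_assoc, H; ring. }
  split; [|split]; [assumption..|].
  rewrite !Cplus_assoc; field; auto.
Qed.

(** Each of the two denominator symbols gains a factor [(n + x) / n] at its index [x], whence
    [n ^ 2]. *)
Lemma F_n_succ (a b c d e f n : C) (k : nat) :
  n <> 0 -> n + RtoC (INR k) + d <> 0 -> n + RtoC (INR k) + c <> 0 ->
  F_defined a b c d e f n k ->
  F a b c d e f (n + 1) k = F a b c d e f n k *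
    (n ^ 2 / ((n + RtoC (INR k) + d) * (n + RtoC (INR k) + c))).
Proof.
  unfold F_defined, F; intros Hn Hd1 Hc1 [_ [_ [Hd [Hc [Hd0 Hc0]]]]].
  pose proof (pochhammer_shift n _ Hn Hd) as HSd.
  pose proof (pochhammer_shift n _ Hn Hc) as HSc.
  rewrite Cplus_assoc in HSd, HSc.
  assert (Hquot : forall p q r, p * n = q * r -> p = q * r / n)
    by (intros p q r H; rewrite <- H; field; assumption).
  apply Hquot in HSd, HSc.
  rewrite HSd, HSc; field; repeat split; assumption.
Qed.

Lemma wz_pair (a b c d e f n : C) (k : nat) :
  n <> 0 -> F_defined a b c d e f n k -> F_defined a b c d e f n (S k) ->
  G a b c d e f n (S k) - G a b c d e f n k =
  p2 a b c d e f n * F a b c d e f n k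
  + p1 a b c d e f n * F a b c d e f (n + 1) k.
Proof.
  intros Hn Hk HSk.
  destruct (F_S a b c d e f n k Hk HSk) as [Hd [Hc HF]].
  rewrite (F_n_succ a b c d e f n k) by assumption.
  unfold G; rewrite HF, INR_S_C.
  (* All terms are now multiples of [F] at [(n, k)]. With that value and [k] replaced by free
     complex variables, a rational identity remains. *)
  generalize dependent (F a b c d e f n k); intros X _.
  generalize dependent (RtoC (INR k)); intros x Hd Hc.
  unfold Rcert, p1, p2; field; split; assumption.
Qed.

(* [G k = (A + B k) F k] with constants [A], [B], so [k (B F k)] tends to [l],
   which is compatible with summability of [B F] only for [l = 0]. *)
Lemma Clim_G (a b c d e f n l : C) :
  ex_series (K := C_AbsRing) (V := C_NormedModule) (F a b c d e f n) ->
  Clim (G a b c d e f n) l -> l = 0.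
Proof.
  intros HF HG.
  pose (B := - n ^ 2 * (c + d + 2 * n - a - b - e - f)).
  pose (A := Rcert a b c d e f n 0).
  assert (HkF : Clim (fun k => RtoC (INR k) * (B * F a b c d e f n k)) l).
  { replace l with (l + - A * 0) by ring.
    apply Clim_ext with (u := fun k =>
      G a b c d e f n k + - A * F a b c d e f n k).
    - intros k; unfold G, A, B, Rcert; ring.
    - apply Clim_plus; [assumption|].
      apply Clim_mult; [apply Clim_const|now apply Clim_series_term]. }
  (* Multiplication by the complex [B] mixes components, so the real-series argument is applied to
     the two parts of [B * F] rather than of [F]. *)
  destruct (ex_series_parts_scal B _ HF) as [Hr Hi].
  destruct HkF as [Hlr Hli].
  apply C_ext.
  - apply (series_mul_INR_lim _ _ Hr).
    eapply is_lim_seq_ext; [|exact Hlr]; intros k; apply re_scal_l.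
  - apply (series_mul_INR_lim _ _ Hi).
    eapply is_lim_seq_ext; [|exact Hli]; intros k; apply im_scal_l.
Qed.

Lemma Csum_n_wz (a b c d e f n : C) (m : nat) :
  n <> 0 -> (forall k, F_defined a b c d e f n k) ->
  p2 a b c d e f n * @sum_n C_AbelianMonoid (F a b c d e f n) m
  + p1 a b c d e f n * @sum_n C_AbelianMonoid (F a b c d e f (n + 1)) m
  = G a b c d e f n (S m) - G a b c d e f n 0.
Proof.
  intros Hn HF; induction m as [|m IH].
  - rewrite !sum_O; symmetry; now apply wz_pair.
  - rewrite !sum_Sn; change (@plus C_AbelianMonoid) with Cplus.
    transitivity ((G a b c d e f n (S (S m)) - G a b c d e f n (S m))
      + (G a b c d e f n (S m) - G a b c d e f n 0)); [|ring].
    rewrite <- IH, wz_pair by auto; ring.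
Qed.

Theorem theorem1 (a b c d e f n : C)
  (Fdef : forall k : nat, F_defined a b c d e f n k)
  (Fdef1 : forall k : nat, F_defined a b c d e f (n + 1) k)
  (cvgF : ex_series (K := C_AbsRing) (V := C_NormedModule) (F a b c d e f n))
  (cvgF1 :
    ex_series (K := C_AbsRing) (V := C_NormedModule) (F a b c d e f (n + 1)))
  (p2_neq0 : p2 a b c d e f n <> 0) :
  calF a b c d e f n =
    g1 a b c d e f n + g2 a b c d e f n * calF a b c d e f (n + 1).
Proof.
  (* Every monomial of [p2] contains [n ^ 2]. *)
  assert (Hn : n <> 0) by (intros ->; apply p2_neq0, p2_n0).
  pose (S0 := calF a b c d e f n); pose (S1 := calF a b c d e f (n + 1)).
  assert (HG : Clim (G a b c d e f n)
    (p2 a b c d e f n * S0 + p1 a b c d e f n * S1 + G a b c d e f n 0)).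
  (* The telescoped sum through index [m] ends at [G] of [S m]. *)
  { apply (Clim_incr_n _ 1).
    apply Clim_ext with (u := fun m =>
      p2 a b c d e f n * @sum_n C_AbelianMonoid (F a b c d e f n) m
      + p1 a b c d e f n * @sum_n C_AbelianMonoid (F a b c d e f (n + 1)) m
      + G a b c d e f n 0).
    - intros m; rewrite Csum_n_wz, Nat.add_1_r by assumption; ring.
    - repeat apply Clim_plus; try apply Clim_const;
        (apply Clim_mult; [apply Clim_const|now apply Clim_CSeries]). }
  (* The limit of [G] found from the two series must be 0; this is the claimed relation multiplied
     by [p2]. *)
  apply Clim_G in HG; [|assumption].
  unfold g1, g2; fold S0 S1.
  assert (H : p2 a b c d e f n * S0
    = - G a b c d e f n 0 - p1 a b c d e f n * S1).
  { transitivity ((p2 a b c d e f n * S0 + p1 a b c d e f n * S1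
      + G a b c d e f n 0) - G a b c d e f n 0 - p1 a b c d e f n * S1);
      [ring|rewrite HG; ring]. }
  transitivity (p2 a b c d e f n * S0 / p2 a b c d e f n);
    [|rewrite H]; field; assumption.
Qed.
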